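(* Let $M\in\mathbb{Z}_{>0}$, and consider the second-order $M$-dimensional discrete Volterra system $y(k)=\theta_1^\top\mu(k)+\theta_2^\top\mu^2(k)$ with parameters $\theta_1\in\mathbb{R}^{M+1}$, $\theta_2\in\mathbb{R}^{\frac12(M+1)(M+2)}$ (see context), and observed input-output sequences $u_{ob,[-M,T]}$ and $y_{ob,[0,T]}$ of this system. If and only if $u_{ob,[-M,T]}$ is persistently exciting of order $L=1$ with respect to the system, the system can be equivalently represented through data as $$\mu(k)=\begin{bmatrix}u(k) & u(k-1) & \cdots & u(k-M)\end{bmatrix}^\top,\qquad y(k)=Y_{ob,\{0,1,T\}}\,\mathcal{M}^{\dagger}_{ob,\{0,1,T\}}\begin{bmatrix}\mu(k)\\ \mu^2(k)\end{bmatrix}.$$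
   Context: Notation: $A^\dagger$ is the Moore-Penrose pseudoinverse of $A$. For symmetric $A\in\mathbb{R}^{n\times n}$, $\mathrm{vech}(A)=[a_{(1,1)}\;a_{(2,1)}\;a_{(2,2)}\;\cdots\;a_{(n,n)}]^\top$ stacks the entries of the lower triangular part. For a vector $u\in\mathbb{R}^m$, $u^2:=\mathrm{vech}(uu^\top)\in\mathbb{R}^{\frac m2(m+1)}$. For a signal $s$, $s_{[k,k+T]}$ stacks $s(k),\dots,s(k+T-1)$ (right endpoint excluded); thus $u_{ob,[-M,T]}$ consists of $u_{ob}(-M),\dots,u_{ob}(T-1)$ and $y_{ob,[0,T]}$ of $y_{ob}(0),\dots,y_{ob}(T-1)$. System: the second-order $M$-dimensional discrete Volterra system with memory length $M\in\mathbb{Z}_{>0}$, scalar input $u(k)$ and scalar output $y(k)$, is $$y(k)=\sum_{i=0}^{M}\alpha_{i+1}u(k-i)+\sum_{i=0}^M\sum_{j=0}^M\beta_{(i+1,j+1)}u(k-i)u(k-j),\quad k\in\mathbb{Z},$$ with real parameters and $\beta_{(i,j)}=\beta_{(j,i)}$. Equivalently $y(k)=\theta_1^\top\mu(k)+\theta_2^\top\mu^2(k)$ with $\mu(k)=[u(k)\;u(k-1)\;\cdots\;u(k-M)]^\top$, $\mu^2(k)=\mathrm{vech}(\mu(k)\mu(k)^\top)$, $\theta_1=[\alpha_1\;\cdots\;\alpha_{M+1}]^\top$, $\theta_2=[\beta_{(1,1)}\;2\beta_{(1,2)}\;\cdots\;\beta_{(M+1,M+1)}]^\top$ (ordered as in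 $\mathrm{vech}$, off-diagonal coefficients doubled). Data: the observed sequences are an input-output pair of the system. Put $\mu_{ob}(k)=[u_{ob}(k)\;\cdots\;u_{ob}(k-M)]^\top$, $\mu^2_{ob}(k)=\mathrm{vech}(\mu_{ob}(k)\mu_{ob}(k)^\top)$, and $$M_{ob,\{0,1,T\}}=[\mu_{ob}(0)\;\cdots\;\mu_{ob}(T-1)],\quad M^2_{ob,\{0,1,T\}}=[\mu^2_{ob}(0)\;\cdots\;\mu^2_{ob}(T-1)],$$ $$Y_{ob,\{0,1,T\}}=[y_{ob}(0)\;\cdots\;y_{ob}(T-1)],\quad \mathcal{M}_{ob,\{0,1,T\}}=\begin{bmatrix}M_{ob,\{0,1,T\}}\\ M^2_{ob,\{0,1,T\}}\end{bmatrix}.$$ ($M^2_{ob}$ is not a matrix square.) Persistence of excitation of order $L=1$ of $u_{ob,[-M,T]}$ with respect to the system means that $\mathcal{M}_{ob,\{0,1,T\}}$ has full row rank, i.e. rank equal to $\frac12(M+1)(M+4)$. That the system is equivalently represented through data means that the data-based formula reproduces the system's output $y(k)$ for the system's input $u$.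
   Formalization: The data-based representation is required for all parameters θ₁, θ₂ (with outputs generated from the same observed input), not for one fixed system: for a fixed system ''only if'' fails, e.g. zero parameters with zero observed input. *)

(* Defs.v *)
From HB Require Import structures.
From mathcomp Require Import all_boot all_order all_algebra.
From mathcomp Require Import reals.

Set Implicit Arguments.
Unset Strict Implicit.
Unset Printing Implicit Defensive.

Import Order.TTheory GRing.Theory Num.Theory.

Local Open Scope ring_scope.

Definition is_moore_penrose (R : realFieldType) (m n : nat)
    (A : 'M[R]_(m, n)) (X : 'M[R]_(n, m)) : Prop :=
  [/\ A *m X *m A = A,
      X *m A *m X = X,
      (A *m X)^T = A *m X &
      (X *m A)^T = X *m A].

Lemma gram_unitmx (R : realFieldType) (m n : nat) (F : 'M[R]_(m, n)) :
  row_free F -> F *m F^T \in unitmx.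
Proof.
move=> Ffree; rewrite -row_free_unit -kermx_eq0; apply/rowV0P => v.
move/sub_kermxP => vFF.
have vF0 : v *m F = 0.
  apply/rowP => j; rewrite [RHS]mxE.
  have : (v *m F *m (v *m F)^T) 0 0 = 0.
    by rewrite trmx_mul mulmxA -(mulmxA v) vFF mul0mx mxE.
  rewrite mxE => /eqP; rewrite psumr_eq0; last first.
    by move=> i _; rewrite [X in _ * X]mxE -expr2 sqr_ge0.
  move/allP => /(_ j (mem_index_enum j)).
  by rewrite /= [X in _ * X]mxE -expr2 sqrf_eq0 => /eqP.
by apply: (row_free_inj Ffree); rewrite vF0 mul0mx.
Qed.

Lemma moore_penrose_unique (R : realFieldType) (m n : nat)
    (A : 'M[R]_(m, n)) (X Y : 'M[R]_(n, m)) :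
  is_moore_penrose A X -> is_moore_penrose A Y -> X = Y.
Proof.
move=> [AXA XAX tAX tXA] [AYA YAY tAY tYA].
have AXAY : A *m X = A *m Y.
  rewrite -[LHS]tAX -{1}AYA -(mulmxA (A *m Y)) trmx_mul tAX tAY.
  by rewrite mulmxA AXA.
have XAYA : X *m A = Y *m A.
  rewrite -[LHS]tXA -{1}AYA -mulmxA mulmxA trmx_mul tYA.
  by rewrite tXA -mulmxA (mulmxA A) AXA.
by rewrite -XAX XAYA -mulmxA AXAY mulmxA YAY.
Qed.

Lemma moore_penrose_exists (R : realFieldType) (m n : nat)
    (A : 'M[R]_(m, n)) : {X : 'M[R]_(n, m) | is_moore_penrose A X}.
Proof.
suff main r (C : 'M[R]_(m, r)) (F : 'M[R]_(r, n)) :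
    row_full C -> row_free F -> A = C *m F ->
    {X : 'M[R]_(n, m) | is_moore_penrose A X}.
  apply: (main _ (col_base A) (row_base A)).
  - exact: col_base_full.
  - exact: row_base_free.
  - by rewrite mulmx_base.
move=> Cfull Ffree AE.
have Fu : F *m F^T \in unitmx by exact: gram_unitmx.
have Cu : C^T *m C \in unitmx.
  rewrite -{2}[C]trmxK; apply: gram_unitmx.
  by rewrite /row_free mxrank_tr.
pose P := F^T *m invmx (F *m F^T); pose Q := invmx (C^T *m C) *m C^T.
have FP : F *m P = 1%:M by rewrite mulmxA mulmxV.
have QC : Q *m C = 1%:M by rewrite -mulmxA mulVmx.
exists (P *m Q).
have AX : A *m (P *m Q) = C *m Q.
  by rewrite AE -mulmxA (mulmxA F) FP mul1mx.
have XA : (P *m Q) *m A = P *m F.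
  by rewrite AE -mulmxA (mulmxA Q) QC mul1mx.
split.
- by rewrite AX AE -mulmxA (mulmxA Q) QC mul1mx.
- by rewrite XA -mulmxA (mulmxA F) FP mul1mx.
- by rewrite AX /Q !trmx_mul trmxK trmx_inv trmx_mul trmxK mulmxA.
- by rewrite XA /P !trmx_mul trmxK trmx_inv trmx_mul trmxK mulmxA.
Qed.

Definition mpinv (R : realFieldType) (m n : nat) (A : 'M[R]_(m, n)) :
  'M[R]_(n, m) := sval (moore_penrose_exists A).

Lemma mpinvP (R : realFieldType) (m n : nat) (A : 'M[R]_(m, n)) :
  is_moore_penrose A (mpinv A).
Proof. exact: svalP. Qed.

Definition lower (n : nat) : {set 'I_n * 'I_n} :=
  [set p : 'I_n * 'I_n | p.2 <= p.1]%N.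

Lemma card_lower (n : nat) : #|lower n| = (n * n.+1)./2.
Proof.
rewrite -sum1_card (eq_bigl (fun p : 'I_n * 'I_n => (p.2 <= p.1)%N)); last first.
  by move=> p; rewrite inE.
rewrite -(pair_big_dep xpredT (fun i j : 'I_n => (j <= i)%N) (fun _ _ => 1%N)) /=.
transitivity (\sum_(i < n) i.+1)%N.
  apply: eq_bigr => i _.
  by rewrite -(big_ord_widen n (fun=> 1%N) (ltn_ord i)) sum1_card card_ord.
elim: n => [|n IHn]; first by rewrite big_ord0.
rewrite big_ord_recr /= IHn.
rewrite -[RHS]/((n.+1 * n.+2)./2)%N.
have -> : (n.+1 * n.+2 = n.+1.*2 + n * n.+1)%N.
  by rewrite -muln2 -addn2 mulnDr addnC [(n * _)%N]mulnC.
by rewrite halfD odd_double doubleK add0n addnC.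
Qed.

(* [enum] lists pairs lexicographically, so the entries of the lower triangle
   come in the order (1,1), (2,1), (2,2), (3,1), ..., (n,n). *)
Definition vech_index (n : nat) (k : 'I_((n * n.+1)./2)) : 'I_n * 'I_n :=
  enum_val (cast_ord (esym (card_lower n)) k).

Definition vech (R : Type) (n : nat) (A : 'M[R]_n) : 'cV[R]_((n * n.+1)./2) :=
  \col_k A (vech_index k).1 (vech_index k).2.

Definition regressor (R : realFieldType) (M : nat) (u : int -> R) (k : int) :
  'cV[R]_M.+1 := \col_(i < M.+1) u (k - i%:Z).

Definition regressor2 (R : realFieldType) (M : nat) (u : int -> R) (k : int) :
    'cV[R]_((M.+1 * M.+2)./2) :=
  vech (regressor M u k *m (regressor M u k)^T).

Definition volterra (R : realFieldType) (M : nat) (theta1 : 'cV[R]_M.+1)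
    (theta2 : 'cV[R]_((M.+1 * M.+2)./2)) (u : int -> R) (k : int) : R :=
  (theta1^T *m regressor M u k + theta2^T *m regressor2 M u k) 0 0.

(* Coefficient form of the system.  The off-diagonal coefficients are doubled in
   theta2 because vech keeps only one of the two equal products
   u (k - i) * u (k - j) and u (k - j) * u (k - i). *)
Definition theta1_of (R : realFieldType) (M : nat) (alpha : 'I_M.+1 -> R) :
  'cV[R]_M.+1 := \col_i alpha i.

Definition theta2_of (R : realFieldType) (M : nat)
    (beta : 'I_M.+1 -> 'I_M.+1 -> R) : 'cV[R]_((M.+1 * M.+2)./2) :=
  vech (\matrix_(i, j) (if i == j then beta i j else 2 * beta i j)).

Lemma volterraE (R : realFieldType) (M : nat) (alpha : 'I_M.+1 -> R)
    (beta : 'I_M.+1 -> 'I_M.+1 -> R) (u : int -> R) (k : int) :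
    (forall i j, beta i j = beta j i) ->
  volterra (theta1_of alpha) (theta2_of beta) u k =
  \sum_(i < M.+1) alpha i * u (k - i%:Z) +
  \sum_(i < M.+1) \sum_(j < M.+1)
    beta i j * u (k - i%:Z) * u (k - j%:Z).
Proof.
move=> betaC; rewrite /volterra mxE; congr (_ + _); rewrite mxE.
  by apply: eq_bigr => i _; rewrite !mxE.
pose f (i j : 'I_M.+1) := beta i j * u (k - i%:Z) * u (k - j%:Z).
have fC i j : f i j = f j i by rewrite /f betaC mulrAC.
pose g (p : 'I_M.+1 * 'I_M.+1) := if p.1 == p.2 then f p.1 p.2 else f p.1 p.2 *+ 2.
transitivity (\sum_(p in lower M.+1) g p).
  rewrite [RHS]big_enum_val /= (reindex (cast_ord (card_lower M.+1))) /=; last first.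
    exists (cast_ord (esym (card_lower M.+1))) => i _;
      by rewrite ?cast_ordK ?cast_ordKV.
  apply: eq_bigr => i _; rewrite !mxE /vech_index cast_ordK big_ord1 !mxE /g /f.
  case: ifP => _; first by rewrite mulrA.
  by rewrite mulr_natl mulrnAl mulrA.
rewrite pair_big /= [RHS](bigID (mem (lower M.+1))) /=.
rewrite [X in _ = _ + X](_ : _ = \sum_(p in lower M.+1 | p.1 != p.2) f p.1 p.2).
  rewrite [in RHS]big_mkcondr /= -big_split /=; apply: eq_bigr => p _.
  rewrite /g; case: eqP => _ /=; by rewrite ?addr0 ?mulr2n.
rewrite (reindex (fun p : 'I_M.+1 * 'I_M.+1 => (p.2, p.1))) /=; last first.
  by exists (fun p => (p.2, p.1)) => -[].
apply: eq_big => [[i j]|[i j] _] /=; last by rewrite -/(f _ _) fC.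
by rewrite !inE /= -ltnNge ltn_neqAle eq_sym andbC; congr (_ && ~~ _).
Qed.

(* Signals are total functions on the integers, but for columns t < T the data
   matrices only involve u_ob (- M), ..., u_ob (T - 1) and
   y_ob 0, ..., y_ob (T - 1). *)
Definition data_M (R : realFieldType) (M T : nat) (u_ob : int -> R) :
    'M[R]_(M.+1, T) :=
  \matrix_(i < M.+1, t < T) regressor M u_ob t%:Z i 0.

Definition data_M2 (R : realFieldType) (M T : nat) (u_ob : int -> R) :
    'M[R]_((M.+1 * M.+2)./2, T) :=
  \matrix_(i < (M.+1 * M.+2)./2, t < T) regressor2 M u_ob t%:Z i 0.

Definition data_calM (R : realFieldType) (M T : nat) (u_ob : int -> R) :
    'M[R]_(M.+1 + (M.+1 * M.+2)./2, T) :=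
  col_mx (data_M M T u_ob) (data_M2 M T u_ob).

Definition data_Y (R : realFieldType) (T : nat) (y_ob : int -> R) :
  'rV[R]_T := \row_(t < T) y_ob t%:Z.

Definition persistently_exciting1 (R : realFieldType) (M T : nat)
    (u_ob : int -> R) : Prop :=
  row_free (data_calM M T u_ob).

Lemma persistently_exciting1_rank (R : realFieldType) (M T : nat)
    (u_ob : int -> R) :
  persistently_exciting1 M T u_ob <->
  \rank (data_calM M T u_ob) = ((M + 1) * (M + 4))./2.
Proof.
rewrite /persistently_exciting1 /row_free.
suff -> : ((M + 1) * (M + 4))./2 = (M.+1 + (M.+1 * M.+2)./2)%N.
  by split => /eqP.
have -> : ((M + 1) * (M + 4) = M.+1.*2 + M.+1 * M.+2)%N.
  by rewrite -muln2 -mulnDr addn1 !addnS addn0.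
by rewrite halfD odd_double doubleK add0n.
Qed.

(* Main.v *)
Require Import Defs.
From HB Require Import structures.
From mathcomp Require Import all_boot all_order all_algebra.
From mathcomp Require Import reals.

Set Implicit Arguments.
Unset Strict Implicit.
Unset Printing Implicit Defensive.

Import Order.TTheory GRing.Theory Num.Theory.

Local Open Scope ring_scope.

(** Write [C] for the stacked data matrix, [C^+] for its pseudoinverse and
    [phi u k] for the stacked regressor at time [k].  The system is linear in its
    parameters: [y k = theta^T phi u k], and the data satisfy [Y = theta^T C].
    Hence the data formula returns [theta^T (C C^+) phi u k], and the theorem
    compares the projector [C C^+] with the identity.

    If [C] has full row rank, [C C^+ = 1] ([row_free_mpinv]) and the formula is
    exact.  Conversely, exactness for every parameter and every input means that
    [1 - C C^+] annihilates every regressor.  Since the input is free, [mu] runs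
    over all vectors, and no nonzero row annihilates [x] stacked on
    [vech (x x^T)] for all [x]: a polynomial without constant term, of degree at
    most two, that vanishes everywhere has zero coefficients
    ([lin_quad_monomials_separate]).  So [C C^+ = 1], and [C] has full row
    rank. *)

Lemma row_free_mpinv (R : realFieldType) (m n : nat) (A : 'M[R]_(m, n)) :
  row_free A <-> A *m mpinv A = 1%:M.
Proof.
have [AXA _ _ _] := mpinvP A.
split=> [/row_freeP [B AB] | AX]; last by apply/row_freeP; exists (mpinv A).
by rewrite -[LHS]mulmx1 -AB mulmxA AXA AB.
Qed.

Lemma vechD (R : nmodType) (n : nat) (A B : 'M[R]_n) :
  vech (A + B) = vech A + vech B.
Proof. by apply/colP => k; rewrite !mxE. Qed.

Lemma vech_index_inj (n : nat) : injective (@vech_index n).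
Proof. by move=> k l /enum_val_inj/cast_ord_inj. Qed.

(** Only diagonal pairs have both orders in the lower triangle. *)
Lemma vech_index_swap (n : nat) (k l : 'I_((n * n.+1)./2)) :
  vech_index l = ((vech_index k).2, (vech_index k).1) -> l = k.
Proof.
move=> lk; apply: vech_index_inj; rewrite lk.
have := enum_valP (cast_ord (esym (card_lower n)) l).
have := enum_valP (cast_ord (esym (card_lower n)) k).
rewrite -/(vech_index k) -/(vech_index l) lk !inE /=.
case: (vech_index k) => i j /= ji ij.
by rewrite (_ : i = j) //; apply/val_inj/eqP; rewrite eqn_leq ij.
Qed.

(** By [vech_index_swap], the entry [(j, i)] is either skipped by [vech] or equal
    to the entry [(i, j)]; so pairing with [E_ij + E_ji] isolates one coefficient
    of [a], doubled on the diagonal. *)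
Lemma mul_vech_delta_sym (R : pzRingType) (n : nat)
    (a : 'rV[R]_((n * n.+1)./2)) (k : 'I_((n * n.+1)./2)) :
  let: (i, j) := vech_index k in
  (a *m vech (delta_mx i j + delta_mx j i)) 0 0 = a 0 k *+ (i == j).+1.
Proof.
case kE: (vech_index k) => [i j].
rewrite mxE (bigD1 k) //= big1 => [|l lk].
  rewrite !mxE kE /= !eqxx addr0 mulrDr mulr1 mulrS; congr (_ + _).
  by rewrite (eq_sym j i) andbb mulr_natr.
rewrite !mxE; case lE: (vech_index l) => [i' j'] /=.
case: andP => [[/eqP ii /eqP jj]|_].
  by case/eqP: lk; apply: vech_index_inj; rewrite kE lE ii jj.
case: andP => [[/eqP ij /eqP ji]|_]; last by rewrite addr0 mulr0.
by case/eqP: lk; apply: vech_index_swap; rewrite kE lE ij ji.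
Qed.

(** Comparing the values at [x] and [- x] separates the linear part from the
    quadratic part; polarizing the latter gives a vanishing symmetric bilinear
    form, whose values on pairs of basis vectors are the coefficients. *)
Lemma lin_quad_monomials_separate (R : numFieldType) (n : nat)
    (a : 'rV[R]_(n + (n * n.+1)./2)) :
  (forall x : 'cV[R]_n, a *m col_mx x (vech (x *m x^T)) = 0) -> a = 0.
Proof.
rewrite -[a]hsubmxK; move: (lsubmx a) (rsubmx a) => b c.
move=> vanish.
have {}vanish (x : 'cV[R]_n) : b *m x + c *m vech (x *m x^T) = 0.
  by rewrite -mul_row_col.
have quad0 (x : 'cV[R]_n) : c *m vech (x *m x^T) = 0.
  have := vanish (- x).
  rewrite [(- x)^T]linearN /= !mulmxN mulNmx opprK => neg.
  have : (c *m vech (x *m x^T)) *+ 2 = 0.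
    by rewrite mulr2n -[RHS]addr0 -{2}neg -(vanish x) addrACA subrr add0r.
  by move/eqP; rewrite -scaler_nat scaler_eq0 pnatr_eq0 => /eqP.
have lin0 (x : 'cV[R]_n) : b *m x = 0.
  by rewrite -(vanish x) quad0 addr0.
have bilin0 (x y : 'cV[R]_n) : c *m vech (x *m y^T + y *m x^T) = 0.
  have := quad0 (x + y).
  rewrite [(x + y)^T]linearD /= mulmxDl !mulmxDr addrA -(addrA (x *m x^T)).
  by rewrite !vechD !mulmxDr !quad0 add0r addr0 -mulmxDr -vechD.
have -> : b = 0.
  by apply/trmx_inj/row_matrixP => j; rewrite -!tr_col !colE lin0 mul0mx.
have -> : c = 0.
  apply/rowP => k; rewrite [RHS]mxE.
  have := mul_vech_delta_sym c k; case: (vech_index k) => i j.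
  have := bilin0 (delta_mx i 0) (delta_mx j 0).
  rewrite !trmx_delta !mul_delta_mx => ->.
  by rewrite mxE => /esym/eqP; rewrite mulrn_eq0 => /eqP.
exact: row_mx0.
Qed.

(** The input is placed backwards in time, at [0, -1, ..., -M]. *)
Lemma regressor_surj (R : realFieldType) (M : nat) (x : 'cV[R]_M.+1) :
  exists u : int -> R, regressor M u 0 = x.
Proof.
exists (fun z => x (inord `|z|%N) 0).
by apply/colP => i; rewrite mxE sub0r abszN inord_val.
Qed.

Lemma volterra_col_mx (R : realFieldType) (M : nat) (theta1 : 'cV[R]_M.+1)
    (theta2 : 'cV[R]_((M.+1 * M.+2)./2)) (u : int -> R) (k : int) :
  volterra theta1 theta2 u k =
  (row_mx theta1^T theta2^T *m col_mx (regressor M u k) (regressor2 M u k)) 0 0.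
Proof. by rewrite mul_row_col. Qed.

Lemma data_Y_volterra (R : realFieldType) (M T : nat) (theta1 : 'cV[R]_M.+1)
    (theta2 : 'cV[R]_((M.+1 * M.+2)./2)) (u_ob y_ob : int -> R) :
  (forall k : int, 0 <= k < T%:Z -> y_ob k = volterra theta1 theta2 u_ob k) ->
  data_Y T y_ob = row_mx theta1^T theta2^T *m data_calM M T u_ob.
Proof.
move=> yE; apply/rowP => t; rewrite mxE yE ?lez_nat ?ltz_nat ?ltn_ord //.
rewrite mul_row_col /volterra !mxE; congr (_ + _);
  by apply: eq_bigr => i _; rewrite !mxE.
Qed.

Theorem corollary1 (R : realType) (M : nat) (hM : (0 < M)%N) (T : nat)
    (u_ob : int -> R) :
  persistently_exciting1 M T u_ob <->
  (forall (theta1 : 'cV[R]_M.+1) (theta2 : 'cV[R]_((M.+1 * M.+2)./2))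
          (y_ob : int -> R),
     (forall k : int, 0 <= k < T%:Z ->
        y_ob k = volterra theta1 theta2 u_ob k) ->
     forall u y : int -> R,
       (forall k : int, y k = volterra theta1 theta2 u k) ->
       forall k : int,
         y k = (data_Y T y_ob *m mpinv (data_calM M T u_ob) *m
                  col_mx (regressor M u k) (regressor2 M u k)) 0 0).
Proof.
set C := data_calM M T u_ob; split.
  move=> /row_free_mpinv CX theta1 theta2 y_ob yobE u y yE k.
  by rewrite yE (data_Y_volterra yobE) -[X in X *m col_mx _ _]mulmxA CX mulmx1
             volterra_col_mx.
move=> exact_repr; apply/row_free_mpinv; rewrite -/C.
apply/row_matrixP => i; apply/eqP; rewrite -subr_eq0 -linearB /=; apply/eqP.
apply: lin_quad_monomials_separate => x.
have [u <-] := regressor_surj x; rewrite -/(regressor2 M u 0).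
(* The parameter vector is the i-th unit vector, which selects row i of the
   projector. *)
pose e : 'rV[R]_(M.+1 + (M.+1 * M.+2)./2) := delta_mx 0 i.
pose theta1 := (lsubmx e)^T; pose theta2 := (rsubmx e)^T.
have eE : row_mx theta1^T theta2^T = e by rewrite !trmxK hsubmxK.
have := exact_repr theta1 theta2 _ (fun k _ => erefl) u _ (fun k => erefl) 0.
rewrite (data_Y_volterra (M := M) (fun k _ => erefl)) volterra_col_mx eE -/C.
move=> fit; apply/matrixP => r s; rewrite !ord1 rowE -/e mulmxBr mulmx1 mulmxBl.
by rewrite [LHS]mxE [X in _ + X]mxE fit mulmxA subrr mxE.
Qed.
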